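(* Let $G$ be a finite group and let $p$ be an odd prime. Then $d_p(G)>(p+1)/(2p)$ if and only if $G$ has a normal $p$-complement and an abelian Sylow $p$-subgroup.
   Context: For a prime $p$, $k_p(G)$ denotes the number of conjugacy classes of $G$ consisting of $p$-elements (elements of $p$-power order, including the identity), and $d_p(G)=k_p(G)/|P|$, where $P$ is a Sylow $p$-subgroup of $G$. A normal $p$-complement of $G$ is a normal subgroup of order prime to $p$ whose index in $G$ is a power of $p$. *)

(* Defs.v *)
From HB Require Import structures.
From mathcomp Require Import all_boot all_order all_fingroup all_algebra all_solvable.

Set Implicit Arguments.
Unset Strict Implicit.
Unset Printing Implicit Defensive.

Import GroupScope.

Section PClasses.

Variables (gT : finGroupType) (p : nat) (G : {group gT}).

Definition kp : nat := #|[set xG in classes G | [forall x in xG, p.-elt x]]|.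

(* The value does not depend on the Sylow subgroup chosen: see dpE. *)
Definition dp : rat := (kp%:R / #|sval (Sylow_exists p G)|%:R)%R.

Lemma dpE (P : {group gT}) : p.-Sylow(G) P -> dp = (kp%:R / #|P|%:R)%R.
Proof.
move=> sylP; rewrite /dp (card_Hall sylP).
by case: (Sylow_exists p G) => Q /= /card_Hall ->.
Qed.

(* For p prime, p.-nat n says that n is a power of p. *)
Definition normal_p_complement (H : {group gT}) : bool :=
  [&& H <| G, coprime p #|H| & p.-nat #|G : H|].

End PClasses.

(* Main.v *)
Require Import Defs.
From HB Require Import structures.
From mathcomp Require Import all_boot all_order all_fingroup all_algebra all_solvable.

Set Implicit Arguments.
Unset Strict Implicit.
Unset Printing Implicit Defensive.

Import GroupScope Order.TTheory GRing.Theory Num.Theory.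

(** If some [w] in [N_G(P)] does not centralize the Sylow subgroup [P], then
    [C_P(w)] has index at least [p] in [P], and every class of p-elements meets
    [P] either in [C_P(w)] or in two distinct elements [x] and [x ^ w]; hence
    [2 k_p(G) <= |P| + |C_P(w)| <= |P| (p + 1) / p]. So a larger [d_p(G)] forces
    [N_G(P) <= C_G(P)], and Burnside's transfer theorem yields the normal
    p-complement. *)

Section Burnside.

Variables (gT : finGroupType) (p : nat) (G P : {group gT}).
Hypotheses (sylP : p.-Sylow(G) P) (cNP : 'N_G(P) \subset 'C(P)).

Let sPG : P \subset G. Proof. exact: pHall_sub sylP. Qed.

Lemma abelian_Sylow_cent_norm : abelian P.
Proof. by apply: subset_trans cNP; rewrite subsetI sPG normG. Qed.

(* [P] and [P :^ y] are both Sylow subgroups of [C_G(u ^ y)], so an element of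
   that centralizer corrects [y] to an element of [N_G(P)]. *)
Lemma Burnside_fusion_trivial u y :
  u \in P -> y \in G -> u ^ y \in P -> u ^ y = u.
Proof.
move=> Pu Gy Puy; have abP := abelian_Sylow_cent_norm.
have sylC (Q : {group gT}) :
    p.-Sylow(G) Q -> u ^ y \in 'C(Q) -> p.-Sylow('C_G[u ^ y]) Q.
  move=> sylQ cQ; apply: pHall_subl (sylQ); rewrite ?subsetIl // subsetI.
  by rewrite (pHall_sub sylQ) sub_cent1.
have sylP1 : p.-Sylow('C_G[u ^ y]) P by apply: sylC => //; apply: (subsetP abP).
have sylP2 : p.-Sylow('C_G[u ^ y]) (P :^ y)%G.
  by apply: sylC; rewrite ?pHallJ //= centJ memJ_conjg (subsetP abP).
have [c /setIP[Gc /cent1P cc] /= defP] := Sylow_trans sylP2 sylP1.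
have NPyc : y * c \in 'N_G(P).
  by rewrite inE groupM //=; apply/normP; rewrite conjsgM -defP.
have /centP/(_ u Pu) cu := subsetP cNP _ NPyc.
have uyc : u ^ (y * c) = u by apply/conjg_fixP/commgP/esym.
by rewrite -[RHS]uyc conjgM; apply/esym/conjg_fixP/commgP.
Qed.

(** The complement is the kernel [K] of the transfer from [G] to the abelian group [P]: it meets [P]
    trivially, and [G / K] is isomorphic to the image of the transfer. *)
Lemma Burnside_normal_p_complement :
  prime p -> exists H : {group gT}, normal_p_complement p G H.
Proof.
move=> p_pr; have abP := abelian_Sylow_cent_norm.
have abI : abelian (idm P @* P) by rewrite morphim_idm.
pose tau := transfer_morphism G abI.
pose K := ('ker tau)%G.
(* Without fusion in [P], the transfer to [P] is [g |-> g ^+ #|G : P|] on [P],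
   which is injective by coprimality. *)
have tauP g : g \in P -> g \in K -> g = 1.
  move=> Pg /kerP Kg; have Gg := subsetP sPG _ Pg.
  have := Kg Gg; rewrite /= /tau /=.
  set X := transversal (rcosets P G :* <[g]>) G.
  have trX : is_transversal X (rcosets P G :* <[g]>) G.
    exact/transversalP/rcosets_cycle_partition.
  rewrite (transfer_cycle_expansion sPG _ Gg trX).
  have eq_g x : x \in X ->
      (g ^+ #|<[g]> : P :* x|) ^ x^-1 = g ^+ #|<[g]> : P :* x|.
    move=> Xx; apply: Burnside_fusion_trivial; rewrite ?groupX ?groupV //.
      exact: (subsetP (transversal_sub trX)).
    (* The exponent is the number of cosets [P :* x * g ^+ i], so this power of [g] fixes
       [P :* x]. *)
    rewrite conjgE invgK mulgA -mem_rcoset; apply: mulg_exp_card_rcosets.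
  under eq_bigr => x Xx do rewrite (eq_g x Xx) /restrm /= /idm.
  have Pg1 : g \in idm P @* P by rewrite morphim_idm.
  under eq_bigr => x Xx do rewrite (FiniteModule.fmodX _ _ Pg1).
  rewrite sumrMnr (sum_index_rcosets_cycle sPG Gg trX) //.
  move/(congr1 val); rewrite FiniteModule.fmvalZ FiniteModule.fmodK //= => gn1.
  have coPn : coprime #|P| #|G : P|.
    by case/and3P: sylP => _ pP p'n; apply: pnat_coprime pP p'n.
  by rewrite -(expgK coPn Pg) gn1 expg1n.
have nsKG : K <| G by apply: ker_normal.
exists K; rewrite /normal_p_complement nsKG andTb; apply/andP; split.
  (* As [K] is normal, [K :&: P] is a Sylow subgroup of [K]; being trivial, it forces [p] not to
     divide the order of [K]. *)
  have := card_Hall (Sylow_setI_normal nsKG sylP).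
  have -> : (K :&: P)%G = 1%G.
    by apply/val_inj/trivgP/subsetP => x /setIP[Kx Px]; apply/set1P/tauP.
  rewrite cards1 => /esym/eqP; rewrite p_part_eq1.
  by rewrite mem_primes p_pr cardG_gt0 /= -prime_coprime.
have <- : #|tau @* G| = #|G : K| by rewrite card_morphim setIid.
(* The transfer takes values in an additive copy of [P]; mapping it back injectively shows that the
   order of the image divides that of [P]. *)
have injv : 'injm (FiniteModule.fmval_morphism abI).
  by apply/injmP => u v _ _; apply: val_inj.
apply: (pnat_dvd (n := #|P|%N)); last exact: pHall_pgroup sylP.
apply: (dvdn_trans (n := #|[set: FiniteModule.fmod_of abI]|)).
  exact: cardSg (subsetT _).
rewrite -(card_injm injv (subxx _)); apply: cardSg.
have sIP : idm P @* P \subset P by rewrite morphim_idm.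
apply/subsetP=> _ /morphimP[u _ _ ->].
exact/(subsetP sIP)/FiniteModule.fmodP.
Qed.
End Burnside.

(** The classes partition [G]; this lets [double_kp_leq] be checked one class at a time. *)
Lemma sum_card_classesI (gT : finGroupType) (G : {group gT}) (S : {set gT}) :
  S \subset G -> (\sum_(xG in classes G) #|xG :&: S|)%N = #|S|.
Proof.
move=> sSG; rewrite -[RHS]sum1_card.
rewrite (partition_big (class^~ G) [in classes G]) => [|x Sx]; last first.
  exact/mem_classes/(subsetP sSG).
apply: eq_bigr => _ /imsetP[x Gx ->]; rewrite sum1dep_card.
apply: eq_card => y; rewrite !inE andbC; congr (_ && _).
by apply/class_eqP/eqP.
Qed.

Section ClassCount.

Variables (gT : finGroupType) (p : nat) (G P : {group gT}).
Hypothesis sylP : p.-Sylow(G) P.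

Let sPG : P \subset G. Proof. exact: pHall_sub sylP. Qed.

Lemma p_class_meets_Sylow xG :
    xG \in classes G -> [forall x in xG, p.-elt x] ->
  exists2 x, x \in P & xG = x ^: G.
Proof.
case/imsetP=> x Gx -> /forall_inP/(_ x (class_refl G x)) px.
have [|y Gy] := Sylow_Jsub sylP _ px; first by rewrite cycle_subG.
rewrite -cycleJ cycle_subG => Pxy; exists (x ^ y) => //.
exact/esym/classGidl.
Qed.

Lemma double_kp_leq w :
  w \in 'N_G(P) -> (2 * kp p G <= #|'C_P[w]| + #|P|)%N.
Proof.
case/setIP=> Gw nPw; have sCG : 'C_P[w] \subset G by rewrite subIset ?sPG.
rewrite -(sum_card_classesI sPG) -(sum_card_classesI sCG) -big_split /=.
rewrite mulnC /kp -sum_nat_const big_mkcond [leqRHS]big_mkcond.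
apply: leq_sum => xG _; rewrite inE; case: ifP => // /andP[clxG].
rewrite clxG => /(p_class_meets_Sylow clxG)[x Px ->].
have [cxw | ncxw] := boolP (x \in 'C[w]).
  (* Here [x] is counted twice, once in ['C_P[w]] and once in [P]. *)
  by apply: (@leq_add 1 1); rewrite card_gt0; apply/set0Pn; exists x;
    rewrite !in_setI class_refl Px.
rewrite (leq_trans _ (leq_addl _ _)) //.
have neq : x ^ w != x.
  by apply: contra ncxw => /eqP/conjg_fixP/commgP cwx; apply/cent1P.
have <- : #|[set x ^ w; x]| = 2 by rewrite cards2 neq.
rewrite subset_leq_card // subUset !sub1set !in_setI class_refl Px.
by rewrite memJ_class // (memJ_norm x nPw) Px.
Qed.

Lemma kp_leq_not_cent :
  ~~ ('N_G(P) \subset 'C(P)) -> (2 * p * kp p G <= p.+1 * #|P|)%N.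
Proof.
case/subsetPn=> w NPw ncw; have := double_kp_leq NPw.
have iC_gt1 : (1 < #|P : 'C_P[w]|)%N.
  by rewrite indexg_gt1 subsetI subxx sub_cent1.
have : (p * #|'C_P[w]| <= #|P|)%N.
  rewrite -(Lagrange (subsetIl P 'C[w])) mulnC leq_mul2l.
  (* A power of [p] greater than 1 is at least [p]. *)
  have /p_natP[[|k] ik] : p.-nat #|P : 'C_P[w]|.
  - exact: pnat_dvd (dvdn_indexg _ _) (pHall_pgroup sylP).
  - by rewrite ik in iC_gt1.
  by rewrite dvdn_leq ?orbT // [X in _ %| X]ik dvdn_exp.
move=> leC le2; rewrite mulnAC mulnC.
apply: leq_trans (_ : p * (#|'C_P[w]| + #|P|) <= _)%N.
  by rewrite leq_mul2l le2 orbT.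
by rewrite mulnDr mulSn leq_add2r.
Qed.

(** Distinct elements of [P] lie in distinct classes of [G]: conjugate elements agree in the abelian
    quotient [G / H], and [P] embeds there since it meets [H] trivially. *)
Lemma kp_geq_Sylow (H : {group gT}) :
  abelian P -> normal_p_complement p G H -> (#|P| <= kp p G)%N.
Proof.
move=> abP /and3P[/andP[sHG nHG] cop iH].
have pP := pHall_pgroup sylP.
have abGH : abelian (G / H).
  have pGH : p.-group (G / H) by rewrite /pgroup card_quotient.
  (* The image of [P] is Sylow in the p-group [G / H], hence all of it. *)
  have sylPH := quotient_pHall (subset_trans sPG nHG) sylP.
  by rewrite -(pHall_id sylPH pGH) quotient_abelian.
have tiHP : H :&: P = 1.
  apply: coprime_TIg; have /p_natP[n ->] := pP.
  by rewrite coprime_sym coprimeXl.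
have injc : {in P &, injective (class^~ G)}.
  move=> x y Px Py /= eqxy.
  have [Gx Gy] := (subsetP sPG _ Px, subsetP sPG _ Py).
  have : x \in y ^: G by rewrite -eqxy class_refl.
  case/imsetP=> g Gg def_x.
  have coset_xy : coset H x = coset H y.
    rewrite def_x morphJ ?(subsetP nHG) //.
    by apply/conjg_fixP/commgP; apply: (centsP abGH); apply: mem_quotient.
  have : x * y^-1 \in H :&: P.
    rewrite in_setI -mem_rcoset groupM ?groupV // andbT.
    by apply/rcoset_kercosetP; rewrite ?(subsetP nHG).
  by rewrite tiHP => /set1P/eqP; rewrite -eq_mulgV1 => /eqP.
rewrite -(card_in_imset injc) subset_leq_card //.
apply/subsetP=> _ /imsetP[x Px ->]; rewrite inE mem_classes ?(subsetP sPG) //=.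
by apply/forall_inP=> _ /imsetP[g _ ->]; rewrite p_eltJ (mem_p_elt pP).
Qed.

Lemma dp_gtE :
  prime p ->
  ((p%:R + 1) / (2 * p%:R) < dp p G)%R = (p.+1 * #|P| < 2 * p * kp p G)%N.
Proof.
move=> p_pr; rewrite (dpE sylP) -[2%R]/(2%:R)%R -natrM natr1.
rewrite ltr_pdivrMr ?ltr0n ?muln_gt0 ?prime_gt0 //.
rewrite mulrAC ltr_pdivlMr ?ltr0n ?cardG_gt0 // -!natrM ltr_nat.
by rewrite (mulnC (kp p G)).
Qed.

End ClassCount.

Theorem theoremD (gT : finGroupType) (G : {group gT}) (p : nat)
    (p_prime : prime p) (p_odd : odd p) :
  ((p%:R + 1) / (2 * p%:R) < dp p G)%R <->
  (exists H : {group gT}, normal_p_complement p G H) /\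
  (exists P : {group gT}, p.-Sylow(G) P /\ abelian P).
Proof.
split=> [dp_gt | [[H complH] [P [sylP abP]]]]; last first.
  rewrite (dp_gtE sylP) //.
  apply: leq_trans (_ : 2 * p * #|P| <= _)%N; last first.
    by rewrite leq_mul2l (kp_geq_Sylow sylP abP complH) orbT.
  (* Once the order of [P] is cancelled, [p + 1 < 2 * p] remains, which amounts to [1 < p]. *)
  rewrite ltn_pmul2r ?cardG_gt0 // mul2n -addnn -addn1 ltn_add2l.
  exact: prime_gt1.
have [P sylP] := Sylow_exists p G.
have cNP : 'N_G(P) \subset 'C(P).
  apply: contraLR dp_gt => /(kp_leq_not_cent sylP).
  by rewrite (dp_gtE sylP) // -leqNgt.
split; first exact: Burnside_normal_p_complement sylP cNP p_prime.
by exists P; split; last exact: abelian_Sylow_cent_norm sylP cNP.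
Qed.
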